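(* Let $G$ be a finite, simple, undirected, connected graph without isolated vertices. Then $\chi_{ON}(G)\le {\sf dc}(G)+3$.
   Context: A CFON coloring of a graph $G=(V,E)$ using $k$ colors is an assignment $C:V(G)\to\{1,\dots,k\}$ such that for every $v\in V(G)$ there exists $i\in\{1,\dots,k\}$ with $|N(v)\cap C^{-1}(i)|=1$, where $N(v)$ is the open neighborhood of $v$. $\chi_{ON}(G)$ is the smallest number of colors required for a CFON coloring of $G$. The distance to cluster ${\sf dc}(G)$ is the size of the smallest set $X\subseteq V$ such that $G[V\setminus X]$ is a disjoint union of cliques. *)

(* Defs.v *)
(** Conflict-free coloring on open neighborhoods (CFON) and distance to cluster.
    A finite simple graph is a symmetric irreflexive relation
    [e : rel T] on a finite type [T]. *)
From mathcomp Require Import all_boot.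

Set Implicit Arguments.
Unset Strict Implicit.
Unset Printing Implicit Defensive.

Section Graph.
Variables (T : finType) (e : rel T).

Definition open_nbhd (v : T) : {set T} := [set w | e v w].

Definition no_isolated : Prop := forall v : T, open_nbhd v != set0.

(* The vertex-free graph also satisfies this condition. *)
Definition connected_graph : Prop := forall x y : T, connect e x y.

Definition CFON_coloring (k : nat) (C : {ffun T -> 'I_k}) : bool :=
  [forall v, exists i : 'I_k, #|open_nbhd v :&: C @^-1: [set i]| == 1].

Definition CFON_colorable (k : nat) : bool :=
  [exists C : {ffun T -> 'I_k}, CFON_coloring C].

Lemma CFON_colorable_ex : no_isolated -> exists k, CFON_colorable k.
Proof.
move=> iso; exists #|T|; apply/existsP; exists [ffun x => enum_rank x].
apply/forallP=> v; have /set0Pn[w vw] := iso v.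
apply/existsP; exists (enum_rank w); apply/eqP.
suff -> : open_nbhd v :&: [ffun x => enum_rank x] @^-1: [set enum_rank w] = [set w]
  by rewrite cards1.
apply/setP=> x; rewrite !inE ffunE (inj_eq enum_rank_inj).
by case: eqP => [->|]; rewrite ?andbF // andbT; move: vw; rewrite inE.
Qed.

(* A graph with an isolated vertex has no CFON coloring, so the minimum is
   only defined in their absence. *)
Definition chi_ON (iso : no_isolated) : nat := ex_minn (CFON_colorable_ex iso).

(* The subgraph induced on [A] is a disjoint union of cliques: the blocks of
   [P] are its cliques, and there is no edge between different blocks. *)
Definition union_of_cliques (A : {set T}) : bool :=
  [exists P : {set {set T}}, partition P A &&
    [forall x in A, forall y in A,
      e x y == (x != y) && [exists B in P, (x \in B) && (y \in B)]]].

Definition dc_of_size (k : nat) : bool :=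
  [exists X : {set T}, (#|X| == k) && union_of_cliques (~: X)].

Lemma dc_of_size_ex : exists k, dc_of_size k.
Proof.
exists #|T|; apply/existsP; exists setT; rewrite cardsT eqxx setCT /=.
apply/existsP; exists set0; apply/andP; split.
  by rewrite partition_set0.
by apply/forall_inP=> x; rewrite inE.
Qed.

Definition dc : nat := ex_minn dc_of_size_ex.

End Graph.

(* Main.v *)
(** Let X be a minimum set whose removal leaves cliques. Give each x in X its
    own color, and use three extra colors 0, 1, 2. Only the set X0 of vertices
    of X without neighbor in X needs more care: choose for each x in X0 a
    neighbor f x, with as few distinct values as possible, let I = f(X0), and
    give w in I the color of some g w in X0 with f (g w) = w. Then x sees the
    color of g (f x) only at f x. In each clique K with vertices outside I, one
    of these, a K, gets color 0 and the others color 1, so that all the others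
    see color 0 once. A suitable choice of g makes a K satisfied as well, unless
    its neighbors in X are exactly the g w with w in K; minimality of I then
    forces f to send only one vertex into K, and its image gets color 2.
    Minimality again shows that this vertex has no other neighbor of color 2. *)
Require Import Defs.
From mathcomp Require Import all_boot.

Section Colorings.
Variables (T : finType) (e : rel T).

Definition unique_nbr (S : eqType) (c : T -> S) (v : T) : Prop :=
  exists2 w, e v w & forall u, e v u -> c u = c w -> u = w.

(** Ranking inside [A] is injective on the values of [c], so a palette of any type costs only its
    size. *)
Lemma CFON_colorable_card (S : finType) (A : {set S}) (c : T -> S) :
  (forall v, c v \in A) -> (forall v, unique_nbr S c v) ->
  CFON_colorable e #|A|.
Proof.
move=> cA cP; apply/existsP; exists [ffun v => enum_rank_in (cA v) (c v)].
apply/forallP=> v; have [w vw wP] := cP v.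
apply/existsP; exists (enum_rank_in (cA w) (c w)); apply/cards1P; exists w.
apply/setP=> u; rewrite !inE ffunE; apply/andP/eqP => [[vu /eqP cuw]|->] //.
apply: wP => //; move/(congr1 enum_val): cuw.
by rewrite !enum_rankK_in.
Qed.

Lemma chi_ON_le (e_iso : no_isolated e) (k : nat) :
  CFON_colorable e k -> chi_ON e_iso <= k.
Proof. by rewrite /chi_ON; case: ex_minnP => m _; apply. Qed.

(** This covers an empty modulator. The colors of [a] and [b] occur once each: [a] sees [b], every
    other vertex sees [a]. *)
Lemma complete_CFON_colorable :
  no_isolated e -> (forall x y, e x y = (x != y)) -> CFON_colorable e 3.
Proof.
move=> e_iso eE; rewrite -[3]card_ord -cardsT.
have [a _|T0] := pickP T; last first.
  by apply: (CFON_colorable_card _ _ (fun=> ord0)) => v; have := T0 v.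
have /set0Pn[b] := e_iso a; rewrite inE eE => ab.
pose c v : 'I_3 := inord (if v == a then 0 else if v == b then 1 else 2).
have cE v : c v = (if v == a then 0 else if v == b then 1 else 2) :> nat.
  by rewrite inordK //; do 2?case: ifP.
apply: (CFON_colorable_card _ _ c) => [v|v]; first by rewrite inE.
have [->|va] := eqVneq v a.
  exists b => [|u]; first by rewrite eE.
  rewrite eE eq_sym => /negPf ua /(congr1 val) /=; rewrite !cE ua eqxx.
  by rewrite [b == a]eq_sym (negPf ab); case: eqP.
exists a => [|u _ /(congr1 val) /=]; first by rewrite eE.
by rewrite !cE eqxx; case: eqP => // _; case: ifP.
Qed.

End Colorings.

Section Cluster.
Variables (T S : finType) (e : rel T) (X : {set T}) (b : T -> S).
Hypotheses (e_sym : symmetric e) (e_irr : irreflexive e).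
Hypotheses (e_conn : connected_graph e) (e_iso : no_isolated e).
Hypothesis X_neq0 : X != set0.
Hypothesis bP :
  forall x y, x \notin X -> y \notin X -> e x y = (x != y) && (b x == b y).

(** Otherwise the clique of [v] would be closed under adjacency, and connectivity would put the
    nonempty [X] inside it. *)
Lemma exists_nbr_modulator v : v \notin X ->
  exists u, [/\ u \notin X, b u = b v & [exists x in X, e u x]].
Proof.
move=> vX; pose A := [pred u | (u \notin X) && (b u == b v)].
have [/existsP[u /and3P[uX /eqP uv ux]]|none] :=
  boolP [exists u, [&& u \notin X, b u == b v & [exists x in X, e u x]]].
  by exists u.
have A_closed : closed e A.
  apply: (intro_closed (sym_connect_sym e_sym)) => u w uw /andP[uX uv] /=.
  have wX : w \notin X.
    apply: contra none => wX; apply/existsP; exists u; rewrite uX uv /=.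
    by apply/exists_inP; exists w.
  have := uw; rewrite bP // => /andP[_ /eqP uw'].
  by rewrite inE wX -uw' uv.
have /set0Pn[x xX] := X_neq0.
have := closed_connect A_closed (e_conn v x).
by rewrite !inE vX xX eqxx.
Qed.

Let X0 : {set T} := [set x in X | [forall y in X, ~~ e x y]].

Let X0_X x : x \in X0 -> x \in X.
Proof. by rewrite inE => /andP[]. Qed.

Let X0_nbr x y : x \in X0 -> e x y -> y \notin X.
Proof.
rewrite inE => /andP[_ /forall_inP xP] xy.
by apply/negP=> /xP; rewrite xy.
Qed.

Let selector (f : {ffun T -> T}) := [forall x in X0, e x (f x)].

Lemma exists_min_selector : exists2 f : {ffun T -> T}, selector f &
  forall h : {ffun T -> T}, selector h -> #|f @: X0| <= #|h @: X0|.
Proof.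
have [f0 f0P] : exists f : T -> T, forall x, e x (f x).
  apply: (@fin_all_exists T (fun=> T) (fun x y => e x y)) => x.
  by have /set0Pn[y] := e_iso x; rewrite inE => xy; exists y.
have sel0 : selector [ffun x => f0 x] by apply/forall_inP=> x _; rewrite ffunE.
by case: (arg_minnP (fun f : {ffun T -> T} => #|f @: X0|) sel0) => f fS fM; exists f.
Qed.

Lemma cluster_CFON_colorable : CFON_colorable e (#|X| + 3).
Proof.
have [f /forall_inP fN fmin] := exists_min_selector.
pose I := f @: X0.
have fI x : x \in X0 -> f x \in I by exact: imset_f.
have IX w : w \in I -> w \notin X.
  by case/imsetP=> x xX0 ->; apply: X0_nbr (fN _ xX0).
(* A default value for [a] and [g] where nothing is required of them. *)
have /set0Pn[x1 _] := X_neq0.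
(* In each clique not covered by [I], [a] is a vertex outside [I]; it has a
   neighbour in [X] unless the clique meets [I]. *)
have [a aP] : exists a : S -> T, forall K v, v \notin X -> v \notin I -> b v = K ->
    [/\ a K \notin X, a K \notin I, b (a K) = K
      & (exists2 x, x \in X & e (a K) x) \/ (exists2 w, w \in I & b w = K)].
  pose R K u := forall v, v \notin X -> v \notin I -> b v = K ->
    [/\ u \notin X, u \notin I, b u = K
      & (exists2 x, x \in X & e u x) \/ (exists2 w, w \in I & b w = K)].
  apply: (@fin_all_exists S (fun=> T) R) => K.
  have [/existsP[v /and3P[vX vI /eqP vK]]|none] :=
    boolP [exists v, [&& v \notin X, v \notin I & b v == K]]; last first.
    exists x1 => v vX vI vK; case/negP: none; apply/existsP; exists v.
    by rewrite vX vI vK eqxx.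
  have [/exists_inP[w wI /eqP wK]|noI] := boolP [exists w in I, b w == K].
    by exists v => *; split=> //; right; exists w.
  have [u [uX uv /exists_inP ux]] := exists_nbr_modulator _ vX.
  exists u => *; split=> //; [|by rewrite uv|by left].
  apply: contra noI => uI; apply/exists_inP; exists u => //.
  by rewrite uv vK.
(* Prefer a preimage of [w] not adjacent to [a (b w)]; if there is none, all preimages are adjacent
   to it. *)
have [g gP] : exists g : T -> T, forall w, w \in I ->
    [/\ g w \in X0, f (g w) = w & e (g w) (a (b w)) ->
      forall y, y \in X0 -> f y = w -> e y (a (b w))].
  pose R w x := w \in I -> [/\ x \in X0, f x = w & e x (a (b w)) ->
      forall y, y \in X0 -> f y = w -> e y (a (b w))].
  apply: (@fin_all_exists T (fun=> T) R) => w.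
  have [/existsP[x /and3P[xX0 /eqP xw /negPf xa]]|none] :=
    boolP [exists x, [&& x \in X0, f x == w & ~~ e x (a (b w))]].
    by exists x; split; rewrite ?xa.
  have [/imsetP[x xX0 wE]|/negPf wI] := boolP (w \in I); last first.
    by exists x1; rewrite /R wI.
  exists x; split=> // _ y yX0 yw; apply: contraR none => ya.
  by apply/existsP; exists y; rewrite yX0 yw eqxx.
pose fiber K := g @: [set w in I | b w == K].
(* Here [a K] would see each color [g w] twice, at [g w] and at [w], hence the color 2 for [w]. *)
pose bad K := [set x in X | e (a K) x] == fiber K.
have bad_inj x y : x \in X0 -> y \in X0 ->
    b (f x) = b (f y) -> bad (b (f x)) -> x = y.
  move=> xX0 yX0 fxy /eqP/setP badK; set K := b (f x) in badK fxy.
  (* Badness makes [g (f z)] adjacent to [a K], so by the choice of [g] all preimages of [f z]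
     are. *)
  have aN z : z \in X0 -> b (f z) = K -> e z (a K).
    move=> zX0 zK; have [gX0 gz] := gP _ (fI _ zX0); rewrite zK; apply=> //.
    have := badK (g (f z)); rewrite inE (X0_X _ gX0) e_sym /= => ->.
    by apply: imset_f; rewrite inE fI ?zK /=.
  have gf z : z \in X0 -> b (f z) = K -> g (f z) = z.
    move=> zX0 zK; have := badK z; rewrite inE (X0_X _ zX0) e_sym aN //=.
    case/esym/imsetP=> w; rewrite inE => /andP[wI _] ->.
    by have [_ ->] := gP _ wI.
  have [fE|fNE] := eqVneq (f x) (f y); first by rewrite -(gf x) // fE gf.
  (* Sending the whole fiber over [K] to [a K] would shrink the image. *)
  pose h := [ffun z => if b (f z) == K then a K else f z].
  have hS : selector h.
    apply/forall_inP=> z zX0; rewrite ffunE.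
    by case: eqP => [/(aN _ zX0)|_] //; apply: fN.
  have sub : h @: X0 \subset a K |: (I :\ f x :\ f y).
    apply/subsetP=> _ /imsetP[z zX0 ->]; rewrite ffunE.
    case: eqP => [_|zK]; first by rewrite setU11.
    rewrite !inE fI // andbT; apply/orP; right; apply/andP.
    by split; apply: contra_not_neq zK => ->.
  have := leq_trans (fmin h hS) (subset_leq_card sub).
  have fyI : f y \in I :\ f x by rewrite !inE eq_sym fNE fI.
  rewrite cardsU1 -/I (cardsD1 (f x) I) (cardsD1 (f y) (I :\ f x)) fI // fyI.
  by rewrite addnA leq_add2r leqNgt ltnS leq_b1.
pose c v : T + 'I_3 :=
  if v \in X then inl v
  else if v \in I then (if bad (b v) then inr (inord 2) else inl (g v))
  else if v == a (b v) then inr ord0 else inr (inord 1).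
have n12 : (inord 1 == inord 2 :> 'I_3) = false by rewrite -val_eqE /= !inordK.
have n01 : (ord0 == inord 1 :> 'I_3) = false by rewrite -val_eqE /= !inordK.
have n02 : (ord0 == inord 2 :> 'I_3) = false by rewrite -val_eqE /= !inordK.
have cX x : x \in X -> c x = inl x by rewrite /c => ->.
have c_inl u x : c u = inl x ->
    u = x \/ [/\ u \in I, ~~ bad (b u), g u = x, x \in X0 & u = f x].
  rewrite /c; have [_ [->]|_] := boolP (u \in X); first by left.
  have [uI|_] := boolP (u \in I); last by case: ifP.
  have [gX0 gu _] := gP _ uI.
  by case: ifP => //= nb [<-]; right.
have c_2 u : c u = inr (inord 2) -> u \in I /\ bad (b u).
  rewrite /c; case: ifP => // _; case: ifP => [uI|_]; first by case: ifP.
  by case: ifP => _ [] /eqP; rewrite ?n02 ?n12.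
have c_0 u : c u = inr ord0 -> [/\ u \notin X, u \notin I & u = a (b u)].
  rewrite /c; have [//|uX] := boolP (u \in X).
  have [uI|uI] := boolP (u \in I).
    by case: ifP => // _ [] /eqP; rewrite eq_sym n02.
  by case: eqP => // _ [] /eqP; rewrite eq_sym n01.
pose A := [set inl x | x in X] :|: [set inr i | i : 'I_3] : {set T + 'I_3}.
have cA v : c v \in A.
  have inlA x : x \in X -> inl x \in A.
    by move=> xX; rewrite inE; apply/orP; left; apply: imset_f.
  have inrA i : inr i \in A by rewrite inE; apply/orP; right; apply: imset_f.
  rewrite /c; case: ifP => [/inlA //|_].
  case: ifP => [vI|_]; last by case: ifP.
  by case: ifP => // _; apply: inlA; have [/X0_X] := gP _ vI.
have cardA : #|A| = #|X| + 3.
  rewrite /A cardsU !card_imset ?card_ord; try by move=> ? ? [].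
  rewrite [_ :&: _](_ : _ = set0) ?cards0 ?subn0 //.
  apply/setP=> s; rewrite !inE.
  by apply/negP=> /andP[/imsetP[x _ ->] /imsetP[]].
rewrite -cardA; apply: (CFON_colorable_card _ _ _ _ c) => // v.
have [vX|vX] := boolP (v \in X).
  have [vX0|vX0] := boolP (v \in X0); last first.
    (* The color of [y] could recur only at [f y] with [y] in [X0], but [y] has the neighbor [v] in
       [X]. *)
    move: vX0; rewrite inE vX /= => /forall_inPn[y yX /negPn vy].
    exists y => // u vu; rewrite (cX y) // => /c_inl[//|[_ _ _ yX0 _]].
    by have := X0_nbr y v yX0; rewrite e_sym vX => /(_ vy).
  have wI := fI _ vX0; have [gX0 gw _] := gP _ wI.
  exists (f v) => [|u vu]; first exact: fN.
  rewrite {2}/c (negPf (IX _ wI)) wI.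
  case: ifP => [badv /c_2[uI badu]|_ /c_inl[ug|[_ _ _ _ ->]]]; last 2 first.
  - by have := X0_nbr _ _ vX0 vu; rewrite ug X0_X.
  - by [].
  (* Otherwise [v] could be sent to [u], and [f v] would leave the image. *)
  apply: contraTeq isT => ufv.
  pose h := [ffun z => if z == v then u else f z].
  have hS : selector h.
    by apply/forall_inP=> z zX0; rewrite ffunE; case: eqP => [->|_] //; apply: fN.
  have sub : h @: X0 \subset I :\ f v.
    apply/subsetP=> _ /imsetP[z zX0 ->]; rewrite ffunE !inE.
    (* By [bad_inj], only [v] is sent to [f v]. *)
    case: (z =P v) => [_|zv]; first by rewrite ufv uI.
    rewrite fI // andbT; apply: contra_not_neq zv => zv.
    by apply/esym/bad_inj; rewrite ?zv.
  have := leq_trans (fmin h hS) (subset_leq_card sub).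
  by rewrite -/I (cardsD1 (f v) I) wI add1n ltnn.
have [vI|vI] := boolP (v \in I).
  have [gX0 gv _] := gP _ vI.
  exists (g v) => [|u vu]; first by rewrite e_sym -{2}gv fN.
  rewrite (cX (g v)) ?X0_X // => /c_inl[//|[_ _ _ _ uv]].
  by move: vu; rewrite uv gv e_irr.
have [aX aI ba aR] := aP _ _ vX vI erefl.
have [va|va] := eqVneq v (a (b v)); last first.
  exists (a (b v)) => [|u vu]; first by rewrite bP // va ba eqxx.
  rewrite {2}/c (negPf aX) (negPf aI) ba eqxx => /c_0[uX _ ->].
  by move: vu; rewrite bP // => /andP[_ /eqP <-].
have [badv|] := boolP (bad (b v)).
  (* The fiber is nonempty: a neighbor of [a K] in [X] lies in it by badness. As [w] has color 2,
     the color of [g w] is then seen only at [g w]. *)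
  have [w wI wv] : exists2 w, w \in I & b w = b v.
    case: aR => // -[x xX ax]; move/eqP/setP/(_ x): badv.
    rewrite !inE xX ax => /esym/imsetP[w]; rewrite inE => /andP[wI /eqP wv] _.
    by exists w.
  have [gX0 gw _] := gP _ wI.
  exists (g w) => [|u vu].
    move/eqP/setP/(_ (g w)): badv; rewrite inE -va X0_X //= => ->.
    by apply: imset_f; rewrite inE wI wv /=.
  rewrite (cX (g w)) ?X0_X // => /c_inl[//|[_ nbad _ _ uw]].
  by move: nbad; rewrite uw gw wv badv.
move=> nbad; move: (nbad); rewrite /bad eqEsubset negb_and.
(* Either a neighbor [x] in [X] shares its color with no vertex of the clique, or some [g w] is not
   adjacent to [v], which then sees its color only at [w]. *)
case/orP=> /subsetPn[x].
  rewrite inE -va => /andP[xX vx] xF; exists x => // u vu.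
  rewrite (cX x) // => /c_inl[//|[uI _ gu _ _]].
  case/negP: xF; rewrite -gu; apply: imset_f; rewrite inE uI /=.
  by move: vu; rewrite bP ?(IX u) // (eq_sym (b u)) => /andP[].
case/imsetP=> w; rewrite inE => /andP[wI /eqP wv] ->.
have [gX0 gw _] := gP _ wI.
rewrite inE X0_X //= -va => ngw; exists w => [|u vu].
  rewrite bP ?(IX w) // wv eqxx andbT; apply: contraNneq vI => ->; exact: wI.
rewrite {2}/c (negPf (IX _ wI)) wI wv (negPf nbad).
case/c_inl=> [ug|[_ _ _ _ ->]]; last exact: gw.
by move: vu; rewrite ug (negPf ngw).
Qed.

End Cluster.

Theorem theorem16 (T : finType) (e : rel T)
    (e_sym : symmetric e) (e_irr : irreflexive e)
    (e_conn : connected_graph e) (e_iso : no_isolated e) :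
  chi_ON e_iso <= dc e + 3.
Proof.
apply: chi_ON_le; rewrite /dc; case: ex_minnP => _ /existsP[X /andP[/eqP <-]] + _.
case/existsP=> P /andP[/and3P[/eqP covP trivP _]] /forall_inP PE.
have bP x y : x \notin X -> y \notin X ->
    e x y = (x != y) && (pblock P x == pblock P y).
  move=> xX yX; have xA : x \in ~: X by rewrite inE.
  have yA : y \in ~: X by rewrite inE.
  have /forall_inP/(_ y yA)/eqP -> := PE x xA; congr (_ && _).
  rewrite eq_pblock ?covP //; apply/exists_inP/idP => [[B BP /andP[xB yB]]|xy].
    by rewrite (def_pblock trivP BP xB).
  exists (pblock P x); first by rewrite pblock_mem ?covP.
  by rewrite mem_pblock covP xA.
(* If [X] is empty, connectivity leaves a single clique. *)
have [X0|X0] := eqVneq X set0; last exact: cluster_CFON_colorable bP.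
rewrite X0 cards0; apply: complete_CFON_colorable => // x y.
rewrite bP ?X0 ?inE //.
have cl : closed e [pred z | pblock P x == pblock P z].
  by move=> u w; rewrite bP ?X0 ?inE // => /andP[_ /eqP ->].
by have := closed_connect cl (e_conn x y); rewrite !inE eqxx => <-; rewrite andbT.
Qed.
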